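(* There is no positive integer $n$ with $p^2(n,7)=44$; that is, no positive integer can be expressed as the sum of exactly $7$ positive squares in exactly $44$ ways.
   Context: $p^2(n,j)$ denotes the number of ways to write $n$ as a sum of exactly $j$ positive squares, up to order of summands. *)

(* Defs.v *)
From mathcomp Require Import all_boot.
Set Implicit Arguments.
Unset Strict Implicit.
Unset Printing Implicit Defensive.

(* A way of writing [n] as an unordered sum of [j] positive squares is encoded
   by its nondecreasing [j]-tuple of positive square roots.  Bounding the roots
   by [n] loses nothing, since x <= x ^ 2. *)
Definition p2 (n j : nat) : nat :=
  #|[set t : j.-tuple 'I_n.+1 |
      [&& sorted leq [seq val x | x <- t],
          all (fun x : 'I_n.+1 => 0 < x) t &
          \sum_(x <- t) x ^ 2 == n]]|.

(* Main.v *)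
From Stdlib Require Import BinNat Nnat.
Require Import Defs.
From mathcomp Require Import all_boot.
From mathcomp Require Import all_order all_algebra.
From mathcomp Require Import zify ring.

(** Every [m >= 170] is a sum of exactly five positive squares: write [m - 169]
    as a sum of four squares, drop the zeros, and pad with a representation of
    [169], which is a sum of 1, 2, 3 or 4 positive squares. So for large [n]
    every pair [(a, b)] of positive integers with [a ^ 2 + b ^ 2 <= n - 170] is
    contained in some representation of [n] by seven positive squares. As 44
    representations contain at most [44 * 49] pairs, [p2 n 7 > 44] as soon as
    [n >= 2983]. The remaining [n] are checked by tabulating the number of
    representations. *)

Import GRing.Theory Num.Theory.

(** * Enumeration of the representations *)

(* The nonincreasing sequences of [j] integers in [[1, k]] with sum of squares
   [n]; the inner recursion is [sqparts j k'] (see [sqpartsSS]). *)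
Fixpoint sqparts (j k n : nat) : seq (seq nat) :=
  match j with
  | 0 => if n == 0 then [:: [::]] else [::]
  | j'.+1 =>
    (fix aux k := match k with
      | 0 => [::]
      | k'.+1 => aux k' ++
          (if k ^ 2 <= n then map (cons k) (sqparts j' k (n - k ^ 2)) else [::])
      end) k
  end.

Lemma sqpartsS0 j n : sqparts j.+1 0 n = [::].
Proof. by []. Qed.

Lemma sqpartsSS j k n : sqparts j.+1 k.+1 n = sqparts j.+1 k n ++
  (if k.+1 ^ 2 <= n then map (cons k.+1) (sqparts j k.+1 (n - k.+1 ^ 2))
   else [::]).
Proof. by []. Qed.

(** Induction on [j], then on [k]: a nonincreasing list starts with its maximum, so entries bounded
    by [k.+1] are either bounded by [k] or headed by [k.+1]. *)
Lemma mem_sqparts j k n s : (s \in sqparts j k n) =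
  [&& size s == j, sorted geq s, all (fun x => 0 < x <= k) s &
      \sum_(x <- s) x ^ 2 == n].
Proof.
elim: j k n s => [|j IHj] k n s.
  rewrite /=; case: s => [|x s] /=; last by case: (n == 0); rewrite ?in_nil.
  by rewrite big_nil [0 == n]eq_sym; case: (n == 0).
elim: k n s => [|k IHk] n s.
  rewrite sqpartsS0 in_nil; case: s => [|x s] //=.
  by rewrite leqn0; case: x => [|x]; rewrite /= ?andbF.
rewrite sqpartsSS mem_cat IHk; case: s => [|x s].
  by case: ifP => // _; apply/negP => /mapP[].
rewrite /= !(path_sortedE (rev_trans leq_trans)) big_cons eqSS.
have -> : (x :: s \in if k.+1 ^ 2 <= n then
    [seq k.+1 :: i | i <- sqparts j k.+1 (n - k.+1 ^ 2)] else [::]) =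
  [&& x == k.+1, k.+1 ^ 2 <= n & s \in sqparts j k.+1 (n - k.+1 ^ 2)].
  case: ifP => _; last by rewrite andbF.
  apply/mapP/andP => [[t t_in [-> ->]]|[/eqP-> s_in]]; first by rewrite eqxx.
  by exists s.
rewrite IHj; case: (size s == j) => //=; last by rewrite !andbF.
have [->|x_ne] := eqVneq x k.+1.
  rewrite ltnn leqnn /= !andbF /=.
  have s_geq : all (fun y => 0 < y <= k.+1) s -> all (geq k.+1) s.
    by apply: sub_all => y /andP[].
  have -> : (k.+1 ^ 2 + \sum_(y <- s) y ^ 2 == n) =
      (k.+1 ^ 2 <= n) && (\sum_(y <- s) y ^ 2 == n - k.+1 ^ 2).
    have [le_n|lt_n] := leqP (k.+1 ^ 2) n.
      by rewrite -[in LHS](subnKC le_n) eqn_add2l.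
    by apply/eqP => E; rewrite -E ltnNge leq_addr in lt_n.
  case: (boolP (all _ s)) s_geq => [_ /(_ isT) ->|_ _]; last by rewrite !andbF.
  by rewrite andbCA.
rewrite andFb orbF [x <= k.+1]leq_eqVlt (negPf x_ne) /= ltnS.
case: (boolP (all (geq x) s)) => //= s_le.
case: (boolP (x <= k)) => [xk|]; last by rewrite !andbF.
congr (_ && (_ && _ && _)).
apply: eq_in_all => y y_s; move/allP: s_le => /(_ y y_s) /= yx.
by rewrite (leq_trans yx xk) (leq_trans yx (leqW xk)).
Qed.

Lemma sqparts_uniq j k n : uniq (sqparts j k n).
Proof.
elim: j k n => [|j IHj] k n; first by rewrite /=; case: ifP.
elim: k n => [|k IHk] n; first by [].
rewrite sqpartsSS; case: ifP => _; last by rewrite cats0 IHk.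
rewrite cat_uniq IHk map_inj_uniq ?IHj //; last by move=> s t [].
rewrite andbT; apply/hasPn => _ /mapP[s _ ->].
by rewrite mem_sqparts /= ltnn andbF !andbF.
Qed.

(** Taking values and reversing is a bijection from the nondecreasing tuples onto the nonincreasing
    lists. *)
Lemma p2_sqparts n j : p2 n j = size (sqparts j n n).
Proof.
rewrite /p2 cardE.
set A := enum _.
pose f (t : j.-tuple 'I_n.+1) := rev [seq val x | x <- t].
rewrite -(size_map f).
apply/perm_size/uniq_perm; last 1 first.
- move=> s; rewrite mem_sqparts; apply/mapP/idP => [[t]|].
    rewrite mem_enum inE => /and3P[t_sort t_pos t_sum] ->.
    rewrite size_rev size_map size_tuple eqxx rev_sorted t_sort /=.
    rewrite all_rev all_map (perm_big _ (permEl (perm_rev _))) big_map t_sum andbT.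
    by apply: sub_all t_pos => x /= ->; rewrite -ltnS ltn_ord.
  case/and4P=> /eqP s_size s_sort s_le s_sum.
  have sz : size (rev [seq (inord x : 'I_n.+1) | x <- s]) == j.
    by rewrite size_rev size_map s_size.
  have vals : [seq val x | x <- Tuple sz] = rev s.
    rewrite /= map_rev -map_comp; congr rev; rewrite -[RHS]map_id.
    apply/eq_in_map => x x_s /=; rewrite inordK // ltnS.
    by case/andP: (allP s_le x x_s).
  exists (Tuple sz); last by rewrite /f vals revK.
  rewrite mem_enum inE vals rev_sorted s_sort /=.
  have -> : all (fun x : 'I_n.+1 => 0 < x) (Tuple sz)
     = all (fun x => 0 < x) [seq val x | x <- Tuple sz] by rewrite all_map.
  have -> : \sum_(x <- Tuple sz) x ^ 2 = \sum_(x <- [seq val x | x <- Tuple sz]) x ^ 2.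
    by rewrite big_map.
  rewrite vals all_rev (perm_big _ (permEl (perm_rev _))) s_sum andbT.
  by apply: sub_all s_le => x /andP[].
- rewrite map_inj_uniq ?enum_uniq // => t u /(can_inj revK) /(inj_map val_inj).
  exact: val_inj.
- exact: sqparts_uniq.
Qed.

(** A part has square at most [n], so neither bound excludes anything. This lets a fixed bound serve
    for all small [n]. *)
Lemma sqparts_bound j k l n : n < k.+1 ^ 2 -> n < l.+1 ^ 2 ->
  size (sqparts j k n) = size (sqparts j l n).
Proof.
have le_sum (s : seq nat) x : x \in s -> x ^ 2 <= \sum_(y <- s) y ^ 2.
  by move=> x_s; rewrite (big_rem x) //= leq_addr.
move=> nk nl; apply/perm_size/uniq_perm; try exact: sqparts_uniq.
move=> s; rewrite !mem_sqparts; do 2!congr (_ && _).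
case: eqP => [s_sum|]; last by rewrite !andbF.
rewrite !andbT; apply: eq_in_all => x /le_sum; rewrite s_sum => xn.
have le_root i : n < i.+1 ^ 2 -> x <= i.
  by move=> ni; rewrite -ltnS -ltn_sqr (leq_ltn_trans xn ni).
by rewrite !le_root.
Qed.

(** * Sums of four squares *)

(** Integers, since the product identity and the centered residues involve signs. *)
Definition sum4sq (n : nat) : Prop :=
  exists a b c d : int, (n%:Z = a ^+ 2 + b ^+ 2 + c ^+ 2 + d ^+ 2)%R.

(** Euler's four-square identity, i.e. multiplicativity of the quaternion norm. *)
Lemma sum4sqM m n : sum4sq m -> sum4sq n -> sum4sq (m * n).
Proof.
move=> [a [b [c [d Em]]]] [x [y [z [t En]]]].
exists (a * x + b * y + c * z + d * t)%R, (a * y - b * x + c * t - d * z)%R,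
  (a * z - c * x + d * y - b * t)%R, (a * t - d * x + b * z - c * y)%R.
by rewrite PoszM Em En; ring.
Qed.

Lemma centered_residue (m : nat) (x : int) : 0 < m ->
  exists y k : int, (x = y + m%:Z * k /\ - m%:Z <= 2 * y < m%:Z)%R.
Proof.
move=> m_gt0.
pose h : int := (m %/ 2)%N.
exists (((x + h)%R %% m)%Z - h)%R, ((x + h)%R %/ m)%Z.
split; first by have := divz_eq (x + h)%R m; lia.
have m0 : (m%:Z != 0)%R by lia.
have := modz_ge0 (x + h)%R m0.
have := ltz_mod (x + h)%R m0.
rewrite /h; lia.
Qed.

Lemma centered_sqr_le (m y : int) : (- m <= 2 * y < m -> 4 * y ^+ 2 <= m ^+ 2)%R.
Proof.
case/andP=> ge lt; rewrite -subr_ge0.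
have -> : (m ^+ 2 - 4 * y ^+ 2 = (m - 2 * y) * (m + 2 * y))%R by ring.
by apply: mulr_ge0; lia.
Qed.

Lemma centered_sqr_max (m y : int) :
  (- m <= 2 * y < m -> m ^+ 2 <= 4 * y ^+ 2 -> 2 * y = - m)%R.
Proof.
case/andP=> ge lt le; case: (ltrP (- m) (2 * y)) => [gt|]; last by lia.
have : (0 < (m - 2 * y) * (m + 2 * y))%R by apply: mulr_gt0; lia.
have -> : ((m - 2 * y) * (m + 2 * y) = m ^+ 2 - 4 * y ^+ 2)%R by ring.
by lia.
Qed.

(* The four numbers with sum of squares [m * p] are reduced modulo [m] to [y1],
   ..., [y4] with [2 * `|yi| <= m]; then [R] below is the sum of the [yi ^ 2]
   divided by [m]. No case distinction on the parity of [m] is needed: the only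
   obstruction, [2 * yi = - m] for all [i], also forces [m %| p]. *)
Lemma sum4sq_descent (p m : nat) : prime p -> 1 < m < p -> sum4sq (m * p) ->
  exists2 r, 0 < r < m & sum4sq (r * p).
Proof.
move=> p_pr /andP[m_gt1 m_lt_p] [x1 [x2 [x3 [x4 Ex]]]].
have m_gt0 : 0 < m by exact: ltnW.
have Nmp (q : int) : (p%:Z <> m%:Z * q)%R.
  move=> E; have : m %| p.
    by apply/dvdnP; exists (absz q); rewrite mulnC -[p]/(absz p) E abszM.
  by move/primeP: p_pr => [_ dv] /dv; lia.
have [y1 [k1 [E1 B1]]] := centered_residue m x1 m_gt0.
have [y2 [k2 [E2 B2]]] := centered_residue m x2 m_gt0.
have [y3 [k3 [E3 B3]]] := centered_residue m x3 m_gt0.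
have [y4 [k4 [E4 B4]]] := centered_residue m x4 m_gt0.
(* Expand [m * p] as the sum of the [(yi + m * ki) ^ 2], solve for the sum of the [yi ^ 2], and
   divide by [m]. *)
pose R := (p%:Z - (2 * (k1 * y1 + k2 * y2 + k3 * y3 + k4 * y4)
   + m%:Z * (k1 ^+ 2 + k2 ^+ 2 + k3 ^+ 2 + k4 ^+ 2)))%R.
have ER : (y1 ^+ 2 + y2 ^+ 2 + y3 ^+ 2 + y4 ^+ 2 = m%:Z * R)%R.
  rewrite /R mulrBr -PoszM Ex E1 E2 E3 E4; ring.
have sq_ge0 (y : int) : (0 <= y ^+ 2)%R by exact: sqr_ge0.
have L1 := centered_sqr_le _ _ B1; have L2 := centered_sqr_le _ _ B2.
have L3 := centered_sqr_le _ _ B3; have L4 := centered_sqr_le _ _ B4.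
have m_gt0Z : (0 < m%:Z)%R by lia.
have R_ge0 : (0 <= R)%R.
  by rewrite -(pmulr_rge0 _ m_gt0Z) -ER !addr_ge0.
have R_le : (R <= m%:Z)%R.
  rewrite -(ler_pM2l m_gt0Z) -ER -expr2; clear -L1 L2 L3 L4; lia.
have R_neq0 : R <> 0%R.
  move=> R0; rewrite R0 mulr0 in ER.
  have sq0 (y : int) : (y ^+ 2 <= 0 -> y = 0)%R.
    by move=> le; apply/eqP; rewrite -sqrf_eq0; move: (sq_ge0 y); lia.
  have G1 := sq_ge0 y1; have G2 := sq_ge0 y2.
  have G3 := sq_ge0 y3; have G4 := sq_ge0 y4.
  have y10 : y1 = 0%R by apply: sq0; clear -ER G1 G2 G3 G4; lia.
  have y20 : y2 = 0%R by apply: sq0; clear -ER G1 G2 G3 G4; lia.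
  have y30 : y3 = 0%R by apply: sq0; clear -ER G1 G2 G3 G4; lia.
  have y40 : y4 = 0%R by apply: sq0; clear -ER G1 G2 G3 G4; lia.
  apply: (Nmp (k1 ^+ 2 + k2 ^+ 2 + k3 ^+ 2 + k4 ^+ 2)%R).
  by move: R0; rewrite /R y10 y20 y30 y40; clear; lia.
(* If [R = m], the [4 * yi ^ 2] sum to [4 * m ^ 2] while each is at most [m ^ 2], so all are equal
   to it. *)
have R_neqm : (R <> m%:Z)%R.
  move=> Rm; rewrite Rm in ER.
  have y1m : (2 * y1 = - m%:Z)%R by apply: centered_sqr_max => //; clear -ER L1 L2 L3 L4; lia.
  have y2m : (2 * y2 = - m%:Z)%R by apply: centered_sqr_max => //; clear -ER L1 L2 L3 L4; lia.
  have y3m : (2 * y3 = - m%:Z)%R by apply: centered_sqr_max => //; clear -ER L1 L2 L3 L4; lia.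
  have y4m : (2 * y4 = - m%:Z)%R by apply: centered_sqr_max => //; clear -ER L1 L2 L3 L4; lia.
  apply: (Nmp (1 - (k1 + k2 + k3 + k4) + (k1 ^+ 2 + k2 ^+ 2 + k3 ^+ 2 + k4 ^+ 2))%R).
  have e1 : y1 = y4 by clear -y1m y4m; lia.
  have e2 : y2 = y4 by clear -y2m y4m; lia.
  have e3 : y3 = y4 by clear -y3m y4m; lia.
  have -> : (p%:Z = R + (2 * (k1 * y1 + k2 * y2 + k3 * y3 + k4 * y4)
   + m%:Z * (k1 ^+ 2 + k2 ^+ 2 + k3 ^+ 2 + k4 ^+ 2)))%R by rewrite /R; ring.
  have em : (m%:Z = - (2 * y4))%R by rewrite y4m opprK.
  by rewrite Rm e1 e2 e3 em; ring.
exists (absz R); first by clear -R_ge0 R_le R_neq0 R_neqm; lia.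
(* Euler's identity for the [xi] and the [yi] writes [(m * p) * (m * R)] with four roots divisible
   by [m]; these are the quotients. *)
exists (R + (k1 * y1 + k2 * y2 + k3 * y3 + k4 * y4))%R,
  (k1 * y2 - k2 * y1 + k3 * y4 - k4 * y3)%R,
  (k1 * y3 - k3 * y1 + k4 * y2 - k2 * y4)%R,
  (k1 * y4 - k4 * y1 + k2 * y3 - k3 * y2)%R.
have ep : (p%:Z = R + (2 * (k1 * y1 + k2 * y2 + k3 * y3 + k4 * y4)
   + m%:Z * (k1 ^+ 2 + k2 ^+ 2 + k3 ^+ 2 + k4 ^+ 2)))%R by rewrite /R; ring.
rewrite PoszM gez0_abs // ep.
have -> : (R * (R + (2 * (k1 * y1 + k2 * y2 + k3 * y3 + k4 * y4)
   + m%:Z * (k1 ^+ 2 + k2 ^+ 2 + k3 ^+ 2 + k4 ^+ 2))) =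
   R * (R + 2 * (k1 * y1 + k2 * y2 + k3 * y3 + k4 * y4))
   + (m%:Z * R) * (k1 ^+ 2 + k2 ^+ 2 + k3 ^+ 2 + k4 ^+ 2))%R by ring.
by rewrite -ER; ring.
Qed.

(* Pigeonhole: the residues of the [x ^ 2] and of the [- 1 - y ^ 2], for
   [x, y <= p / 2], are too many to be all distinct modulo [p]. *)
Lemma sum4sq_multiple (p : nat) : prime p ->
  exists2 m, 0 < m < p & sum4sq (m * p).
Proof.
move=> p_pr; have p_gt0 := prime_gt0 p_pr; have p_gt1 := prime_gt1 p_pr.
pose h := (p %/ 2).+1.
have [p2|p_odd] := even_prime p_pr.
  by exists 1 => //; rewrite p2; exists 1%R, 1%R, 0%R, 0%R.
have Eh : p = h.*2.-1 by rewrite /h; lia.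
have sq_inj x y : x < h -> y < h -> x ^ 2 = y ^ 2 %[mod p] -> x = y.
  wlog le_xy : x y / x <= y.
    by move=> W xh yh E; have [/W->//|/ltnW/W<-//] := leqP x y.
  move=> xh yh /esym/eqP; rewrite eqn_mod_dvd ?leq_sqr // subn_sqr Euclid_dvdM //.
  case/orP=> /dvdn_leq; lia.
pose A := [seq x ^ 2 %% p | x <- iota 0 h].
(* The outer reduction only matters for residue 0, where the difference is [p]. *)
pose B := [seq (p - (1 + x ^ 2) %% p) %% p | x <- iota 0 h].
have uA : uniq A.
  rewrite map_inj_in_uniq ?iota_uniq // => x y; rewrite !mem_iota => hx hy.
  exact: sq_inj.
have uB : uniq B.
  rewrite map_inj_in_uniq ?iota_uniq // => x y; rewrite !mem_iota => hx hy E.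
  apply: sq_inj => //; apply/eqP; rewrite -(eqn_modDl 1); apply/eqP.
  have := ltn_pmod (1 + x ^ 2) p_gt0; have := ltn_pmod (1 + y ^ 2) p_gt0.
  move: E; move: ((1 + x ^ 2) %% p) ((1 + y ^ 2) %% p) => u v E vp up.
  have Z w : 0 < w -> w < p -> (p - w) %% p = p - w by move=> *; rewrite modn_small //; lia.
  case: u v up vp E => [|u] [|v] up vp //; rewrite ?subn0 ?modnn ?Z //; lia.
have : ~~ uniq (A ++ B).
  apply/negP => uAB.
  have : size (A ++ B) <= size (iota 0 p).
    apply: uniq_leq_size uAB _ => z; rewrite mem_cat mem_iota /= add0n.
    by case/orP => /mapP[x _ ->]; rewrite ltn_pmod.
  by rewrite size_cat !size_map !size_iota; lia.
rewrite cat_uniq uA uB andTb andbT negbK => /hasP[z /mapP[y y_h ->] /mapP[x x_h E]].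
rewrite !mem_iota /= !add0n in x_h y_h.
have dv : p %| x ^ 2 + y ^ 2 + 1.
  have := ltn_pmod (1 + y ^ 2) p_gt0 => lt1.
  rewrite -addnA [y ^ 2 + 1]addnC /dvdn -modnDm -E modnDml.
  by rewrite subnK ?modnn // ltnW.
case/dvdnP: dv => m Em; exists m.
  (* Yields [m < p], as [x] and [y] are at most [(p - 1) / 2]. *)
  have : x ^ 2 + y ^ 2 + 1 < p * p.
    have [H -> [H_gt0 [xH yH]]] : exists2 H, p = H.*2.+1 & 0 < H /\ x <= H /\ y <= H.
      by exists h.-1; lia.
    have := leq_mul xH xH; have := leq_mul yH yH.
    rewrite -!mulnn; clear -H_gt0; lia.
  by rewrite Em ltn_pmul2r // => ->; rewrite andbT; case: (m) Em => //; lia.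
rewrite -Em; exists (Posz x), (Posz y), 1%R, 0%R.
rewrite !PoszD -!mulnn !PoszM; ring.
Qed.

(** The descent lowers the multiplier [m] until it reaches 1. *)
Lemma sum4sq_prime (p : nat) : prime p -> sum4sq p.
Proof.
move=> p_pr; have [m] := sum4sq_multiple p p_pr.
elim/ltn_ind: m => m IH /andP[m_gt0 m_lt] mp.
have [m_gt1|m_le1] := ltnP 1 m.
  have [|r /andP[r0 rm] rp] := sum4sq_descent p m p_pr _ mp; first by rewrite m_gt1.
  by apply: (IH r) => //; rewrite r0 (ltn_trans rm).
have m1 : m = 1 by lia.
by rewrite m1 mul1n in mp.
Qed.

Theorem lagrange_four_squares (n : nat) : sum4sq n.
Proof.
elim/ltn_ind: n => n IH.
have [n_gt1|n_le1] := ltnP 1 n; last first.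
  by exists (Posz n), 0%R, 0%R, 0%R; case: n n_le1 {IH} => [|[]].
rewrite -(divnK (pdiv_dvd n)); apply: sum4sqM.
  apply: IH; rewrite ltn_Pdiv ?(ltnW n_gt1) //.
  by rewrite prime_gt1 // pdiv_prime.
exact/sum4sq_prime/pdiv_prime.
Qed.

(** * Sums of five positive squares *)

Lemma five_positive_squares (n : nat) : 170 <= n ->
  exists s : seq nat, [/\ size s = 5, all (leq 1) s & \sum_(x <- s) x ^ 2 = n].
Proof.
move=> n_ge; have [a [b [c [d E]]]] := lagrange_four_squares (n - 169).
pose t := [seq x <- [:: absz a; absz b; absz c; absz d] | 0 < x].
have t_sum : \sum_(x <- t) x ^ 2 = n - 169.
  rewrite /t big_filter big_mkcond /=.
  transitivity (\sum_(x <- [:: absz a; absz b; absz c; absz d]) x ^ 2).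
    by apply: eq_bigr => -[].
  have sq_absz (x : int) : Posz (absz x ^ 2) = (x ^+ 2)%R.
    by rewrite -mulnn PoszM abszE -normrM ger0_norm -expr2 ?sqr_ge0.
  rewrite !big_cons big_nil addn0; apply/eqP; rewrite -eqz_nat E.
  by rewrite !PoszD !sq_absz !addrA.
have t_pos : all (leq 1) t by exact: filter_all.
have t_size : size t <= 4 by rewrite size_filter (leq_trans (count_size _ _)).
have [u [u_size u_pos u_sum]] : exists u : seq nat,
    [/\ size u = 5 - size t, all (leq 1) u & \sum_(x <- u) x ^ 2 = 169].
  (* Here [170 <= n] is used: [n - 169] is positive, so at most four squares of padding remain to be
     found. *)
  have : 0 < size t by case: (t) t_sum => //; rewrite big_nil; lia.
  case: (size t) t_size => [|[|[|[|[|k]]]]] // _ _.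
  - by exists [:: 11; 4; 4; 4]; split=> //; rewrite !big_cons big_nil.
  - by exists [:: 12; 4; 3]; split=> //; rewrite !big_cons big_nil.
  - by exists [:: 12; 5]; split=> //; rewrite !big_cons big_nil.
  - by exists [:: 13]; split=> //; rewrite !big_cons big_nil.
exists (t ++ u); split; first by rewrite size_cat u_size; lia.
  by rewrite all_cat t_pos.
by rewrite big_cat /= t_sum u_sum; lia.
Qed.
(** * Tabulation *)

(** On coefficient lists: [s + X ^ q * t], truncated to the length of [s]. *)
Fixpoint shift_add (q : nat) (s t : seq N) : seq N :=
  match s, t with
  | x :: s', y :: t' => match q with
      | 0 => (x + y)%num :: shift_add 0 s' t'
      | q'.+1 => x :: shift_add q' s' t
      end
  | _, _ => s
  end.

Lemma size_shift_add q s t : size (shift_add q s t) = size s.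
Proof. by elim: s q t => [|x s IHs] [|q] [|y t] //=; rewrite IHs. Qed.

Lemma nth_shift_add q s t n : size s = size t -> n < size s ->
  nth 0%num (shift_add q s t) n =
  if q <= n then (nth 0 s n + nth 0 t (n - q)%N)%num else nth 0%num s n.
Proof.
move=> /eq_leq; elim: s q t n => [|x s IHs] [|q] [|y t] [|n] //= st ns.
- by rewrite IHs // subn0.
- by rewrite IHs // leqW.
Qed.

(** Passes from bound [k] to [k.+1], with [q = k.+1 ^ 2]. The shifted summand is the already updated
    previous row, because the part [k.+1] may be repeated. *)
Fixpoint next_rows (q : nat) (prev : seq N) (rows : seq (seq N)) :=
  if rows is r :: rows' then
    let r' := shift_add q r prev in r' :: next_rows q r' rows'
  else [::].

(* Row [i] lists the sizes of [sqparts i.+1 k n] for [n <= M]; the row for zero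
   parts is [1 :: nseq M 0] for all [k]. *)
Fixpoint sqparts_table (M k : nat) : seq (seq N) :=
  if k is k'.+1 then
    next_rows (k ^ 2) (1%num :: nseq M 0%num) (sqparts_table M k')
  else nseq 7 (nseq M.+1 0%num).

Definition counts_sqparts (M j k : nat) (r : seq N) : Prop :=
  size r = M.+1 /\
  forall n, n <= M -> N.to_nat (nth 0%num r n) = size (sqparts j k n).

Lemma counts_next_rows M j k prev rows : counts_sqparts M j k.+1 prev ->
  (forall i, i < size rows -> counts_sqparts M (j.+1 + i) k (nth [::] rows i)) ->
  forall i, i < size rows ->
    counts_sqparts M (j.+1 + i) k.+1 (nth [::] (next_rows (k.+1 ^ 2) prev rows) i).
Proof.
elim: rows j prev => [|r rows IH] j prev //= [prev_size prev_count] rows_ok i i_lt.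
have [r_size r_count] := rows_ok 0 isT.
have r'_ok : counts_sqparts M j.+1 k.+1 (shift_add (k.+1 ^ 2) r prev).
  split=> [|n nM]; first by rewrite size_shift_add.
  rewrite nth_shift_add ?r_size ?prev_size // sqpartsSS size_cat.
  rewrite addn0 in r_count.
  case: ifP => _; last by rewrite addn0 r_count.
  rewrite N2Nat.inj_add plusE r_count // prev_count ?size_map //.
  exact: leq_trans (leq_subr _ _) nM.
case: i i_lt => [|i] i_lt; first by rewrite addn0.
rewrite -addSnnS; apply: IH => // {}i {}i_lt.
by rewrite addSnnS; apply: (rows_ok i.+1).
Qed.

Lemma size_next_rows q prev rows : size (next_rows q prev rows) = size rows.
Proof. by elim: rows prev => //= r rows IH prev; rewrite IH. Qed.

Lemma size_sqparts_table M k : size (sqparts_table M k) = 7.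
Proof. by elim: k => [|k IHk] //=; rewrite size_next_rows. Qed.

Lemma counts_sqparts_table M k i : i < 7 ->
  counts_sqparts M i.+1 k (nth [::] (sqparts_table M k) i).
Proof.
rewrite -[i.+1]add1n; elim: k i => [|k IHk] i i7.
  have -> : nth [::] (sqparts_table M 0) i = nseq M.+1 0%num.
    by rewrite -[sqparts_table M 0]/(nseq 7 (nseq M.+1 0%num)) nth_nseq i7.
  by split=> [|n _]; rewrite ?size_nseq // nth_nseq if_same sqpartsS0.
apply: counts_next_rows; rewrite ?size_sqparts_table //.
split=> [|[|n] _] /=; rewrite ?size_nseq //.
by rewrite nth_nseq if_same.
Qed.

Lemma sqparts_table_check :
  all (fun c => ~~ N.eqb c 44) (nth [::] (sqparts_table 3000 54) 6).
Proof. by vm_compute. Qed.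

Lemma p2_7_neq_44_small n : n <= 3000 -> p2 n 7 <> 44.
Proof.
move=> n_le; rewrite p2_sqparts (@sqparts_bound _ _ 54); first last.
- by apply: leq_ltn_trans n_le _.
- by rewrite -mulnn leq_pmulr.
have := counts_sqparts_table 3000 54 6 isT; have := sqparts_table_check.
move: (nth [::] (sqparts_table 3000 54) 6) => r r_neq [r_size r_count] E.
have n_lt : n < size r by rewrite r_size ltnS.
have /negP := allP r_neq _ (mem_nth 0%num n_lt); apply.
by rewrite -[nth _ r n]N2Nat.id (r_count n n_le) E.
Qed.

(** * Large numbers *)

Definition small_pairs (K M : nat) : seq (nat * nat) :=
  [seq ab <- allpairs pair (iota 1 K) (iota 1 K) | ab.1 ^ 2 + ab.2 ^ 2 <= M].

(* Each pair [(a, b)] extends to a way of writing [n], since [n - a ^ 2 - b ^ 2]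
   is a sum of five positive squares; a given way contains at most [7 * 7] pairs. *)
Lemma size_small_pairs_le (K M n : nat) : M + 170 <= n ->
  size (small_pairs K M) <= p2 n 7 * (7 * 7).
Proof.
move=> n_ge; rewrite p2_sqparts; set L := sqparts 7 n n.
pose pairs s := allpairs (@pair nat nat) s s.
have sub : {subset small_pairs K M <= flatten (map pairs L)}.
  move=> [a b]; rewrite mem_filter /= => /andP[ab_le /allpairsP[[x y]]] /=.
  rewrite !mem_iota => -[/andP[a_gt0 _] /andP[b_gt0 _] [Ea Eb]]; subst x y.
  have [|s [s_size s_pos s_sum]] := five_positive_squares (n - (a ^ 2 + b ^ 2)).
    by rewrite leq_subRL; lia.
  (* Sorting gives the member of [L] that uses [a], [b] and the five roots in [s]. *)
  pose t := sort geq [:: a, b & s].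
  have t_perm : perm_eq t [:: a, b & s] by rewrite perm_sort.
  have t_sum : \sum_(x <- t) x ^ 2 = n.
    by rewrite (perm_big _ t_perm) !big_cons s_sum /= addnA subnKC //; lia.
  have t_mem x : x \in [:: a, b & s] -> x \in t by rewrite (perm_mem t_perm).
  apply/flatten_mapP; exists t; last first.
    by apply: allpairs_f; apply: t_mem; rewrite !inE eqxx ?orbT.
  rewrite mem_sqparts (perm_size t_perm) /= s_size t_sum !eqxx andbT /=.
  rewrite sort_sorted; last by move=> x y; exact: leq_total.
  apply/allP => x x_t; rewrite -t_sum (big_rem x) //=; apply/andP; split.
    move: x_t; rewrite (perm_mem t_perm) !inE => /or3P[/eqP->|/eqP->|] //.
    exact: (allP s_pos).
  apply: leq_trans (leq_addr _ _); rewrite -mulnn.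
  by case: (x) => // z; rewrite leq_pmulr.
have pairs_uniq : uniq (small_pairs K M).
  by rewrite filter_uniq // allpairs_uniq ?iota_uniq // => -[? ?] [? ?] _ _ [-> ->].
apply: leq_trans (uniq_leq_size pairs_uniq sub) _.
have : all (fun s : seq nat => size s == 7) L.
  by apply/allP => s; rewrite mem_sqparts => /and4P[].
elim: (L) => //= s L' IH /andP[/eqP s_size /IH{}IH].
by rewrite size_cat size_allpairs s_size mulSn leq_add2l.
Qed.

(** The bound 53 loses no pair, since [2813 < 54 ^ 2]. As [2813 + 170 <= 3000], this covers all [n]
    beyond the table. *)
Lemma small_pairs_check : 44 * (7 * 7) < size (small_pairs 53 2813).
Proof. by vm_compute. Qed.

Theorem theorem6p5 : ~ (exists n : nat, 0 < n /\ p2 n 7 = 44).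
Proof.
case=> n [_ p2_n]; have [n_le|n_gt] := leqP n 3000.
  exact: p2_7_neq_44_small n_le p2_n.
have /(size_small_pairs_le 53) : 2813 + 170 <= n by lia.
by rewrite p2_n leqNgt small_pairs_check.
Qed.
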